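(* Let $t\geq 2$ be an integer and let $q$ be a prime power with $q\geq 2t-1$. Then there exists a $q^t$-CMS$(q^t,t)$, i.e. a set of $q^t$ complementary $t$-multimagic squares of order $q^t$.
   Context: Let $I_n=\{0,1,\dots,n-1\}$. An $n\times n$ integer matrix is a general magic square if all row sums, column sums, the main diagonal sum and the back diagonal sum (entries $(i,n-1-i)$) are equal. A general magic square $M=(m_{i,j})$ is a general $t$-multimagic square if each entrywise power $M^{*e}=(m_{i,j}^e)$, $e=1,\dots,t$, is a general magic square; if moreover its entries are exactly $0,1,\dots,n^2-1$ (consecutive integers) it is an MS$(n,t)$. Define $S_e(n)=\frac{1}{n}\sum_{k\in I_{n^2}}k^e$. Let $B_s=(b^{(s)}_{i,j})$, $s\in I_m$, be $m$ MS$(n,t)$s with entries $0,\dots,n^2-1$. Then $\{B_0,\dots,B_{m-1}\}$ is a set of complementary $t$-multimagic squares, denoted $m$-CMS$(n,t)$, if (R1) $\sum_{s\in I_m}\sum_{j\in I_n}(b^{(s)}_{i,j})^{t+1}=mS_{t+1}(n)$ for every $i\in I_n$; (R2) $\sum_{s\in I_m}\sum_{i\in I_n}(b^{(s)}_{i,j})^{t+1}=mS_{t+1}(n)$ for every $j\in I_n$; (R3) $\sum_{s\in I_m}\sum_{i\in I_n}(b^{(s)}_{i,i})^{t+1}=\sum_{s\in I_m}\sum_{i\in I_n}(b^{(s)}_{i,n-1-i})^{t+1}=mS_{t+1}(n)$. *)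

(* Defs.v *)
From mathcomp Require Import all_boot all_order all_algebra.
Set Implicit Arguments. Unset Strict Implicit. Unset Printing Implicit Defensive.
Import GRing.Theory Num.Theory.
Local Open Scope ring_scope.

(* Square matrices of order n are 'M[nat]_n, indexed by I_n = 'I_n.
   Entries of an MS(n,t) are 0..n^2-1, hence natural numbers. *)

Definition general_magic (n : nat) (M : 'M[nat]_n) : Prop :=
  exists c : nat,
    (forall i : 'I_n, (\sum_(j < n) M i j)%N = c) /\
    (forall j : 'I_n, (\sum_(i < n) M i j)%N = c) /\
    (\sum_(i < n) M i i)%N = c /\
    (\sum_(i < n) M i (rev_ord i))%N = c.

Definition epow (n e : nat) (M : 'M[nat]_n) : 'M[nat]_n :=
  \matrix_(i, j) (M i j ^ e)%N.

Definition general_multimagic (n t : nat) (M : 'M[nat]_n) : Prop :=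
  forall e, (1 <= e <= t)%N -> general_magic (epow e M).

Definition consecutive_entries (n : nat) (M : 'M[nat]_n) : Prop :=
  perm_eq [seq M p.1 p.2 | p : 'I_n * 'I_n] (iota 0 (n ^ 2)%N).

Definition MS (n t : nat) (M : 'M[nat]_n) : Prop :=
  general_multimagic t M /\ consecutive_entries M.

Definition S (e n : nat) : rat :=
  (\sum_(k < (n ^ 2)%N) (k ^ e)%N)%:R / n%:R.

Definition CMS (m n t : nat) (B : 'I_m -> 'M[nat]_n) : Prop :=
  injective B /\
  (forall s, MS t (B s)) /\
  (forall i : 'I_n,
     ((\sum_(s < m) \sum_(j < n) (B s i j) ^ t.+1)%N)%:R = m%:R * S t.+1 n :> rat) /\
  (forall j : 'I_n,
     ((\sum_(s < m) \sum_(i < n) (B s i j) ^ t.+1)%N)%:R = m%:R * S t.+1 n :> rat) /\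
  ((\sum_(s < m) \sum_(i < n) (B s i i) ^ t.+1)%N)%:R = m%:R * S t.+1 n :> rat /\
  ((\sum_(s < m) \sum_(i < n) (B s i (rev_ord i)) ^ t.+1)%N)%:R
     = m%:R * S t.+1 n :> rat.

Definition prime_power (q : nat) : Prop :=
  exists p k : nat, prime p /\ (0 < k)%N /\ q = (p ^ k)%N.

(* Main.v *)
(* Index rows and columns by [X = F ^ t], where [F] is the field with [q]
   elements, and let the [2 t] base-[q] digits of the entry at [(x, y)] be linear
   forms [D_k (x, y)]. If the forms jointly separate the cells, the entries are
   [0 .. q ^ (2 t) - 1]; if any [t] of them separate the points of every row,
   column and (broken) diagonal, expanding the powers shows that the moments up
   to order [t] are the same on all these lines. Such forms are
   [D_k (x, y) = V_k (x + g_k y)], with [V_k] the evaluation of polynomials of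
   degree less than [t] at [2 t <= q + 1] points of the projective line, and
   [g_k] equal to [a] for [k < t] and to [b] otherwise, where [a <> b] avoid [0],
   [1] and [-1]. The complementary squares are the translates of this one by the
   vectors [(s, a s)].

   For the back diagonal, rows and columns are enumerated so that reversal of
   indices becomes [x |-> c - x]. *)
Require Import Defs.
From mathcomp Require Import all_boot all_order all_algebra.
From mathcomp Require Import all_field zify ring.
Import GRing.Theory Num.Theory.

Set Implicit Arguments. Unset Strict Implicit. Unset Printing Implicit Defensive.

(** * Base-[q] digits and moments of families of words *)

Lemma digit_sum_lt (q m : nat) (d : 'I_m -> nat) :
  (forall k, d k < q) -> \sum_(k < m) d k * q ^ k < q ^ m.
Proof.
elim: m d => [|m IH] d dlt; first by rewrite big_ord0 expn0.
rewrite big_ord_recr /=.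
have := IH _ (fun k => dlt (widen_ord (leqnSn m) k)) => /=.
have : (d ord_max).+1 * q ^ m <= q ^ m.+1 by rewrite expnS leq_mul2r dlt orbT.
by rewrite mulSn; lia.
Qed.

Lemma digit_sum_inj (q m : nat) (d d' : 'I_m -> nat) :
    (forall k, d k < q) -> (forall k, d' k < q) ->
  \sum_(k < m) d k * q ^ k = \sum_(k < m) d' k * q ^ k -> forall k, d k = d' k.
Proof.
elim: m d d' => [|m IH] d d' dlt d'lt; first by move=> _ [].
rewrite !big_ord_recr /=.
set w := widen_ord (leqnSn m).
have lt1 := digit_sum_lt (fun k => dlt (w k)).
have lt2 := digit_sum_lt (fun k => d'lt (w k)).
rewrite addnC [RHS]addnC => eqs.
have q0 : 0 < q ^ m by apply: leq_ltn_trans lt1.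
have eqm : d ord_max = d' ord_max.
  have := congr1 (divn^~ (q ^ m)) eqs.
  by rewrite /= !divnMDl // !divn_small // !addn0.
move: eqs; rewrite eqm => /addnI /(IH _ _ (fun k => dlt _) (fun k => d'lt _)) eqw.
move=> k; case: (unliftP ord_max k) => [j ->|-> //].
have -> : lift ord_max j = w j by apply: val_inj; rewrite /= /bump leqNgt ltn_ord.
exact: eqw.
Qed.

Lemma set_extend (T : finType) (A : {set T}) (t : nat) :
  #|A| <= t <= #|T| -> exists2 B : {set T}, A \subset B & #|B| = t.
Proof.
move=> /andP[]; elim: t => [|t IH] At tT.
  by exists A => //; apply/eqP; rewrite -leqn0.
case: (ltngtP #|A| t.+1) At => // [At _|eqA _]; last by exists A.
have [||B AB Bt] := IH; [by [] | exact: ltnW |].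
have [x xB] : exists x, x \notin B.
  apply/existsP; rewrite -negb_forall; apply: contraTN tT => /forallP allB.
  rewrite -leqNgt -Bt; apply/subset_leq_card/subsetP => y _; exact: allB.
exists (x |: B); last by rewrite cardsU1 xB Bt.
by apply: subset_trans AB _; apply: subsetUr.
Qed.

(* [a] and [b] are families of words over [F] of which every [t] letters
   determine the index; as [#|X| = #|F| ^ t], every choice of [t] letters occurs
   exactly once, so both families have the same moments up to order [t]. *)
Lemma moment_eq (F X : finType) (m t e : nat) (a b : X -> 'I_m -> F)
    (w : 'I_m -> F -> nat) :
    e <= t <= m -> #|X| = #|F| ^ t ->
    (forall A : {set 'I_m}, #|A| = t -> forall x y, {in A, a x =1 a y} -> x = y) ->
    (forall A : {set 'I_m}, #|A| = t -> forall x y, {in A, b x =1 b y} -> x = y) ->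
  \sum_x (\sum_k w k (a x k)) ^ e = \sum_x (\sum_k w k (b x k)) ^ e.
Proof.
move=> /andP[et tm] cardX inja injb.
(* A monomial of the expanded power is indexed by the position [h i] that its [i]-th factor comes
   from. *)
have expand (c : X -> 'I_m -> F) : \sum_x (\sum_k w k (c x k)) ^ e =
    \sum_(h : {ffun 'I_e -> 'I_m}) \sum_x \prod_(i < e) w (h i) (c x (h i)).
  rewrite exchange_big; apply: eq_bigr => x _ /=.
  rewrite -(bigA_distr_bigA (fun (_ : 'I_e) k => w k (c x k))).
  by rewrite prod_nat_const card_ord.
rewrite !expand; apply: eq_bigr => h _.
(* A monomial involves at most [e <= t] positions. Once these are enlarged to exactly [t], the
   letters at them biject [X] with all functions from [A] to [F], for [a] as for [b]. *)
have [|A hA At] := @set_extend 'I_m [set h i | i in 'I_e] t.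
  rewrite card_ord tm andbT; apply: leq_trans et.
  by apply: leq_trans (leq_imset_card _ _) _; rewrite card_ord.
pose proj (c : X -> 'I_m -> F) x := [ffun k : {k | k \in A} => c x (val k)].
have proj_bij (c : X -> 'I_m -> F) :
    (forall x y, {in A, c x =1 c y} -> x = y) -> bijective (proj c).
  move=> injc; apply: inj_card_bij.
    move=> x y /ffunP eqp; apply: injc => k kA.
    by have := eqp (Sub k kA); rewrite !ffunE.
  by rewrite card_ffun card_sig cardX -At.
have [pa _ _] := proj_bij a (inja A At).
have [pb pbK pbK'] := proj_bij b (injb A At).
rewrite [RHS](reindex (pb \o proj a)); last first.
  by apply: onW_bij; apply: bij_comp; [exists (proj b) | exact: proj_bij (inja A At)].
apply: eq_bigr => x _; apply: eq_bigr => i _ /=.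
have hiA : h i \in A by apply: (subsetP hA); apply: imset_f.
have := congr1 (fun g : {ffun {k | k \in A} -> F} => g (Sub (h i) hiA))
          (pbK' (proj a x)).
by rewrite !ffunE /= => ->.
Qed.

(** * Enumerations, and involutions as reversal of indices *)

Lemma perm_image_iota (T : finType) (N : nat) (f : T -> nat) :
  injective f -> (forall x, f x < N) -> #|T| = N ->
  perm_eq [seq f x | x : T] (iota 0 N).
Proof.
move=> injf ltf cardT.
have uf : uniq [seq f x | x : T] by rewrite map_inj_uniq // enum_uniq.
apply: uniq_perm; rewrite ?iota_uniq //.
apply: (uniq_min_size uf _ _).2; last by rewrite size_iota size_map -cardE cardT.
by move=> k /imageP[x _ ->]; rewrite mem_iota /= add0n ltf.
Qed.

(** Each pair [x], [f x] is placed at the two ends, around an arrangement of the rest; the fixed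
    point, if there is one, ends up in the middle. *)
Lemma involution_rev_seq (T : eqType) (f : T -> T) (s : seq T) :
    involutive f -> (forall x y, f x = x -> f y = y -> x = y) ->
    uniq s -> {in s, forall x, f x \in s} ->
  exists2 s', perm_eq s' s & map f s' = rev s'.
Proof.
move=> fK fix1; have [n] := ubnP (size s); elim: n s => // n IH s ltn us fs.
have [/hasP[x xs nfx]|/hasPn allfix] := boolP (has (fun x => f x != x) s); last first.
  exists s => //; case: s us allfix {ltn fs} => [//|x [|y s]].
    by move=> _ /(_ x (mem_head _ _)) /negPn/eqP /= ->.
  rewrite /= inE negb_or => /andP[/andP[/eqP nxy _] _] allfix.
  case: nxy; apply: fix1; apply/eqP/negPn/allfix; rewrite !inE eqxx ?orbT //.
pose s1 := [seq y <- s | (y != x) && (y != f x)].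
have ps : perm_eq s (x :: f x :: s1).
  apply: uniq_perm => // [|y].
    by rewrite /= !inE !mem_filter !eqxx ?andbF /= eq_sym orbF nfx filter_uniq.
  rewrite !inE mem_filter; case: eqVneq => [-> //|_] /=.
  by case: eqVneq => [->|_] //=; rewrite fs.
have [||y|s' ps' rs'] := IH s1.
- by move: ltn; rewrite (perm_size ps) /=; lia.
- exact: filter_uniq.
- rewrite !mem_filter => /andP[/andP[yx yfx] /fs ->]; rewrite andbT.
  by rewrite (inj_eq (inv_inj fK)) yx andbT; apply: contraNneq yfx => <-; rewrite fK.
exists (x :: rcons s' (f x)).
  rewrite (permPr ps) perm_cons perm_rcons perm_cons //.
by rewrite /= map_rcons fK rs' rev_cons rev_rcons rcons_cons.
Qed.

Lemma involution_rev_ord (T : finType) (f : T -> T) (n : nat) :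
    #|T| = n -> involutive f -> (forall x y, f x = x -> f y = y -> x = y) ->
  exists2 phi : 'I_n -> T, injective phi & forall i, phi (rev_ord i) = f (phi i).
Proof.
move=> cardT fK fix1.
have [|s ps rs] := involution_rev_seq fK fix1 (enum_uniq T).
  by move=> x _; rewrite mem_enum.
have sizes : size s = n by rewrite (perm_size ps) -cardE.
pose u : n.-tuple T := tcast sizes (in_tuple s).
have us : u = s :> seq T by rewrite val_tcast.
exists (tnth u); first by apply/tuple_uniqP; rewrite us (perm_uniq ps) enum_uniq.
move=> i; pose x0 := tnth u i.
rewrite !(tnth_nth x0) us -(nth_map _ (f x0)) ?sizes // rs.
by rewrite nth_rev ?sizes //; apply: set_nth_default; rewrite sizes ltn_ord.
Qed.

(** * From magic forms to complementary squares *)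

Local Open Scope ring_scope.

Definition magic_direction (X : zmodType) (x y : X) : Prop :=
  [\/ x = 0, y = 0, y = x | y = - x].

(* The forms [D k] give the base-[q] digits of the entry in row [x] and
   column [y]. *)
Definition magic_forms (F X : zmodType) (t : nat)
    (D : 'I_(2 * t) -> X -> X -> F) : Prop :=
  [/\ forall k x y x' y', D k (x - x') (y - y') = D k x y - D k x' y',
      forall x y, (forall k, D k x y = 0) -> x = 0 /\ y = 0 &
      forall A : {set 'I_(2 * t)}, #|A| = t ->
        forall x y, magic_direction x y -> {in A, forall k, D k x y = 0} ->
        x = 0 /\ y = 0].

(* The squares are the toroidal translates [(x, y) |-> M (x + s, y + J s)] of a
   single one. The hypotheses on [J] say that, along a fixed line, the
   translates together run through every cell of [M] exactly once. *)
Lemma CMS_of_magic_forms (F X : finZmodType) (q t : nat)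
    (D : 'I_(2 * t) -> X -> X -> F) (J : X -> X) (c : X) :
    #|F| = q -> #|X| = (q ^ t)%N -> magic_forms D ->
    injective J -> injective (fun x => x - J x) -> injective (fun x => x + J x) ->
    (forall x y : X, x + x = c -> y + y = c -> x = y) ->
  exists B : 'I_(q ^ t) -> 'M[nat]_(q ^ t), CMS t B.
Proof.
move=> cardF cardX [DB Dinj Dline] Jinj JBinj JDinj cfix.
set n := (q ^ t)%N.
have [||phi phi_inj phi_rev] := @involution_rev_ord X (fun x => c - x) n cardX.
- by move=> x; rewrite subKr.
- by move=> x y /eqP + /eqP; rewrite !subr_eq => /eqP hx /eqP hy; apply: cfix.
pose delta (z : F) : nat := enum_rank z.
have delta_lt z : (delta z < q)%N by rewrite -cardF; apply: ltn_ord.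
have delta_inj : injective delta by move=> x y /val_inj /enum_rank_inj.
pose M x y := (\sum_(k < 2 * t) delta (D k x y) * q ^ k)%N.
have M_lt x y : (M x y < n ^ 2)%N.
  by rewrite -expnM mulnC; apply: digit_sum_lt.
have D_inj x y x' y' : (forall k, D k x y = D k x' y') -> x = x' /\ y = y'.
  move=> eqD; have [|/eqP + /eqP] := Dinj (x - x') (y - y').
    by move=> k; rewrite DB eqD subrr.
  by rewrite !subr_eq0 => /eqP -> /eqP ->.
have M_inj x y x' y' : M x y = M x' y' -> x = x' /\ y = y'.
  move=> /digit_sum_inj eqM; apply: D_inj => k; apply: delta_inj.
  by apply: (eqM (fun k => delta_lt _) (fun k => delta_lt _)).
pose B (s : 'I_n) : 'M[nat]_n := \matrix_(i, j) M (phi i + phi s) (phi j + J (phi s)).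
pose line (l : 'I_n -> X * X) := forall i j,
  magic_direction ((l i).1 - (l j).1) ((l i).2 - (l j).2) /\ (l i = l j -> i = j).
have line_moment e (l l' : 'I_n -> X * X) : (e <= t)%N -> line l -> line l' ->
    (\sum_(i < n) M (l i).1 (l i).2 ^ e)%N = (\sum_(i < n) M (l' i).1 (l' i).2 ^ e)%N.
  have line_inj l0 : line l0 -> forall A : {set 'I_(2 * t)}, #|A| = t ->
      forall i j, {in A, (fun k => D k (l0 i).1 (l0 i).2) =1
                         (fun k => D k (l0 j).1 (l0 j).2)} -> i = j.
    move=> ll A At i j eqA; have [dir injl] := ll i j.
    have [|/eqP + /eqP] := Dline A At _ _ dir.
      by move=> k kA; rewrite DB eqA // subrr.
    rewrite !subr_eq0 => /eqP e1 /eqP e2; apply: injl.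
    by rewrite [l0 i]surjective_pairing e1 e2 -surjective_pairing.
  move=> et ll ll'.
  apply: (@moment_eq F 'I_n (2 * t) t e (fun i k => D k (l i).1 (l i).2)
    (fun i k => D k (l' i).1 (l' i).2) (fun k z => delta z * q ^ k)%N).
  + by rewrite et leq_pmull.
  + by rewrite card_ord cardF.
  + exact: line_inj.
  + exact: line_inj.
have subDD (x y z : X) : x + z - (y + z) = x - y by rewrite opprD addrACA subrr addr0.
have row_line x d : line (fun j => (x, phi j + d)).
  move=> i j; split=> /=; first by rewrite subrr; apply: Or41.
  by case=> /addIr /phi_inj.
have col_line y d : line (fun i => (phi i + d, y)).
  move=> i j; split=> /=; first by rewrite subrr; apply: Or42.
  by case=> /addIr /phi_inj.
have diag_line d d' : line (fun i => (phi i + d, phi i + d')).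
  move=> i j; split=> /=; first by rewrite !subDD; apply: Or43.
  by case=> /addIr /phi_inj.
have adiag_line d d' : line (fun i => (phi i + d, phi (rev_ord i) + d')).
  move=> i j; split=> /=.
    rewrite !subDD !phi_rev; apply: Or44.
    by rewrite !opprB addrC subrKA.
  by case=> /addIr /phi_inj.
have n_gt0 : (0 < n)%N by rewrite /n -cardX; apply/card_gt0P; exists 0.
have B_entries s : injective (fun p : 'I_n * 'I_n => B s p.1 p.2).
  by move=> [i j] [i' j'] /=; rewrite !mxE => /M_inj[/addIr/phi_inj -> /addIr/phi_inj ->].
(* The [n * n] distinct cells are all the cells, so the entries met are [0 .. n ^ 2 - 1]. This
   covers the exponent [t.+1], out of reach of [line_moment]. *)
have total e (g : 'I_n -> 'I_n -> X * X) :
    (forall s i s' i', g s i = g s' i' -> s = s' /\ i = i') ->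
    ((\sum_(s < n) \sum_(i < n) M (g s i).1 (g s i).2 ^ e)%N)%:R
      = n%:R * S e n :> rat.
  move=> g_inj; rewrite /S mulrC divfK ?pnatr_eq0 -?lt0n //; congr (_%:R).
  rewrite pair_big /=.
  have gp : perm_eq [seq M (g p.1 p.2).1 (g p.1 p.2).2 | p : 'I_n * 'I_n]
                    (iota 0 (n ^ 2)).
    apply: perm_image_iota; last by rewrite card_prod card_ord mulnn.
      move=> [s i] [s' i'] /= /M_inj[e1 e2].
      have /g_inj [-> ->] // : g s i = g s' i'.
      by rewrite [LHS]surjective_pairing e1 e2 -surjective_pairing.
    by move=> p; apply: M_lt.
  have := perm_big (op := addn) (x := 0%N) _ gp.
  move=> /(_ predT (fun k => k ^ e)%N); rewrite big_map big_enum /= => ->.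
  by rewrite -(big_mkord predT (fun k => k ^ e)%N) /index_iota subn0.
exists B; split.
  move=> s s' /matrixP eqB.
  have /= := eqB (Ordinal n_gt0) (Ordinal n_gt0).
  by rewrite !mxE => /M_inj[/addrI/phi_inj ->].
split.
  move=> s; split; last first.
    apply: perm_image_iota => //; last by rewrite card_prod card_ord mulnn.
    by move=> p; rewrite mxE.
  move=> e /andP[_ et].
  exists (\sum_(i < n) M (phi i + phi s)%R (phi i + J (phi s))%R ^ e)%N.
  (* Every line is compared with the main diagonal, whose sum is the magic constant. *)
  have mom l (ll : line l) := line_moment e l _ et ll (diag_line (phi s) (J (phi s))).
  split=> [i|].
    under eq_bigr do rewrite !mxE.
    exact: mom (row_line (phi i + phi s) (J (phi s))).
  split=> [j|].
    under eq_bigr do rewrite !mxE.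
    exact: mom (col_line (phi j + J (phi s)) (phi s)).
  split; first by under eq_bigr do rewrite !mxE.
  under eq_bigr do rewrite !mxE.
  exact: mom (adiag_line (phi s) (J (phi s))).
split=> [i|].
  under eq_bigr do under eq_bigr do rewrite !mxE.
  apply: (total t.+1 (fun s j => (phi i + phi s, phi j + J (phi s)))).
  by move=> s j s' j' [/addrI/phi_inj -> /addIr/phi_inj ->].
split=> [j|].
  under eq_bigr do under eq_bigr do rewrite !mxE.
  apply: (total t.+1 (fun s i => (phi i + phi s, phi j + J (phi s)))).
  by move=> s i s' i' [+ /addrI/Jinj/phi_inj ess]; rewrite ess => /addIr/phi_inj ->.
split.
  under eq_bigr do under eq_bigr do rewrite !mxE.
  apply: (total t.+1 (fun s i => (phi i + phi s, phi i + J (phi s)))).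
  move=> s i s' i' [e1 e2].
  (* Subtracting the coordinates eliminates [phi i] and leaves [phi s - J (phi s)]. *)
  have /phi_inj ess : phi s = phi s'.
    have subDl (x y z : X) : z + x - (z + y) = x - y by rewrite ![z + _]addrC subDD.
    by apply: JBinj; have := congr2 (fun x y => x - y) e1 e2; rewrite /= !subDl.
  by move: e1; rewrite ess => /addIr/phi_inj ->.
under eq_bigr do under eq_bigr do rewrite !mxE.
apply: (total t.+1 (fun s i => (phi i + phi s, phi (rev_ord i) + J (phi s)))).
move=> s i s' i'; rewrite !phi_rev => -[e1 e2].
(* Here the coordinates add up to [c + (phi s + J (phi s))]. *)
have /phi_inj ess : phi s = phi s'.
  apply: JDinj; have := congr2 +%R e1 e2.
  by rewrite addrACA [phi i + _]addrC subrK [RHS]addrACA [phi i' + _]addrC subrK => /addrI.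
by move: e1; rewrite ess => /addIr/phi_inj ->.
Qed.

(** * Magic forms from polynomial evaluation *)

(* Evaluation at a point of the projective line, [None] being infinity, of the
   polynomial of degree less than [t] with coefficient vector [v]. *)
Definition proj_eval (F : fieldType) (t : nat) (p : option F) (v : 'rV[F]_t) : F :=
  if p is Some a then (rVpoly v).[a] else (rVpoly v)`_t.-1.

Lemma proj_evalB (F : fieldType) (t : nat) (p : option F) (v w : 'rV[F]_t) :
  proj_eval p (v - w) = proj_eval p v - proj_eval p w.
Proof. by case: p => [a|] /=; rewrite linearB ?hornerD ?hornerN ?coefB. Qed.

Lemma proj_evalZ (F : fieldType) (t : nat) (p : option F) a (v : 'rV[F]_t) :
  proj_eval p (a *: v) = a * proj_eval p v.
Proof. by case: p => [b|] /=; rewrite linearZ ?hornerZ ?coefZ. Qed.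

(** A zero at infinity lowers the degree bound by one, which makes up for the one finite root
    missing. *)
Lemma proj_eval_eq0 (F : finFieldType) (t : nat) (A : {set option F}) (v : 'rV[F]_t) :
  (t <= #|A|)%N -> {in A, forall p, proj_eval p v = 0} -> v = 0.
Proof.
case: t v => [|t] v tA evA; first by rewrite thinmx0.
pose E := [set a | Some a \in A].
have cardA : #|A| = ((None \in A) + #|E|)%N.
  rewrite (cardsD1 None); congr (_ + _)%N.
  have -> : A :\ None = Some @: E.
    apply/setP => -[a|]; first by rewrite !inE (mem_imset _ _ Some_inj) inE.
    by rewrite !inE; apply/esym/negbTE/imsetP => -[].
  exact: card_imset Some_inj.
suff v0 : rVpoly v = 0 by rewrite -[v]rVpolyK v0 linear0.
have size_v : (size (rVpoly v) <= t.+1)%N by apply: size_poly.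
apply: (@roots_geq_poly_eq0 _ _ (enum E)).
- apply/allP => a; rewrite mem_enum inE => /evA ev0; exact/eqP.
- exact: enum_uniq.
rewrite -cardE; move: tA; rewrite cardA.
case: (boolP (None \in A)) => [/evA /= top0|_] /= tE; last exact: leq_trans tE.
apply: leq_trans (tE : (t <= _)%N); apply/leq_sizeP => j.
rewrite leq_eqVlt => /predU1P[<- //|tj].
by apply: nth_default; apply: leq_trans tj.
Qed.

(** In a magic direction, [D k] is [V_k] of a single vector times [g k], [1], [1 + g k] or
    [1 - g k], all nonzero. For joint separation, the two halves of the forms give [x + a *: y = 0]
    and [x + b *: y = 0]. *)
Lemma magic_forms_proj_eval (F : finFieldType) (t : nat) (a b : F) :
    (2 * t <= #|F|.+1)%N -> a != b -> a \notin [:: 0; 1; -1] ->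
    b \notin [:: 0; 1; -1] ->
  exists D : 'I_(2 * t) -> 'rV[F]_t -> 'rV[F]_t -> F, magic_forms D.
Proof.
move=> leF ab a3 b3.
have leo : (2 * t <= #|{: option F}|)%N by rewrite card_option.
pose pt (k : 'I_(2 * t)) : option F := enum_val (widen_ord leo k).
have pt_inj : injective pt by move=> k l /enum_val_inj /(congr1 val) /= /val_inj.
have pt_eq0 (A : {set 'I_(2 * t)}) (v : 'rV[F]_t) : #|A| = t ->
    {in A, forall k, proj_eval (pt k) v = 0} -> v = 0.
  move=> At ev0; apply: (@proj_eval_eq0 _ _ (pt @: A)).
    by rewrite card_imset ?At.
  by move=> _ /imsetP[k kA ->]; apply: ev0.
pose g (k : 'I_(2 * t)) := if (k < t)%N then a else b.
have g3 k : g k \notin [:: 0; 1; -1] by rewrite /g; case: ifP.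
exists (fun k x y => proj_eval (pt k) (x + g k *: y)); split.
- move=> k x y x' y'; rewrite -proj_evalB; congr proj_eval.
  by rewrite scalerBr opprD addrACA.
- move=> x y D0.
  have half (h : 'I_t -> 'I_(2 * t)) c : injective h -> (forall i, g (h i) = c) ->
      x + c *: y = 0.
    move=> h_inj gh; apply: (@pt_eq0 (h @: 'I_t)); first by rewrite card_imset ?card_ord.
    by move=> _ /imsetP[i _ ->]; rewrite -(gh i).
  have lt2 (i : 'I_t) : (t + i < 2 * t)%N by have := ltn_ord i; lia.
  have xa : x + a *: y = 0.
    apply: (half (widen_ord (leq_pmull t (isT : (0 < 2)%N)))) => [i j []|i].
      exact: val_inj.
    by rewrite /g /= ltn_ord.
  have xb : x + b *: y = 0.
    apply: (half (fun i => Ordinal (lt2 i))) => [i j [] /addnI|i]; first exact: val_inj.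
    by rewrite /g /= ltnNge leq_addr.
  have y0 : y = 0.
    have /eqP : (a - b) *: y = 0 by rewrite scalerBl -(subrr 0) -{1}xa -xb opprD addrACA subrr add0r.
    by rewrite scaler_eq0 subr_eq0 (negbTE ab) => /eqP.
  by move: xa; rewrite y0 scaler0 addr0.
move=> A At x y dir D0.
have scaled c (v : 'rV[F]_t) k : c != 0 -> proj_eval (pt k) (c *: v) = 0 ->
    proj_eval (pt k) v = 0.
  by move=> c0 /eqP; rewrite proj_evalZ mulf_eq0 (negbTE c0) => /eqP.
have gN k : [/\ g k != 0, 1 + g k != 0 & 1 - g k != 0].
  have := g3 k; rewrite !inE !negb_or => /and3P[g0 g1 gm].
  by split=> //; [rewrite addrC addr_eq0 | rewrite subr_eq0 eq_sym].
case: dir D0 => [->|->|->|->] D0.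
- split=> //; apply: (pt_eq0 A) => // k kA; have [gk _ _] := gN k.
  by apply: scaled gk _; rewrite -[_ *: _]add0r D0.
- split=> //; apply: (pt_eq0 A) => // k kA.
  by rewrite -[x]addr0 -(scaler0 _ (g k)) D0.
- have x0 : x = 0; last by rewrite x0.
  apply: (pt_eq0 A) => // k kA; have [_ gk _] := gN k.
  by apply: scaled gk _; rewrite scalerDl scale1r D0.
have x0 : x = 0; last by rewrite x0 oppr0.
apply: (pt_eq0 A) => // k kA; have [_ _ gk] := gN k.
by apply: scaled gk _; rewrite scalerBl scale1r -scalerN D0.
Qed.

Lemma CMS_exists_large (F : finFieldType) (q t : nat) :
    #|F| = q -> q%:R = 0 :> F -> (0 < t)%N -> (4 <= q)%N -> (2 * t - 1 <= q)%N ->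
  exists B : 'I_(q ^ t) -> 'M[nat]_(q ^ t), CMS t B.
Proof.
move=> cardF q0 t0 q4 tq.
have [a [b [ab a3 b3]]] : exists a b : F,
    [/\ a != b, a \notin [:: 0; 1; -1] & b \notin [:: 0; 1; -1]].
  pose P := [set x in [:: 0; 1; -1 : F]].
  have Z2 : (1 < #|~: P|)%N.
    have cardP : (#|P| + #|~: P| = q)%N by rewrite -cardF cardsC.
    have le3 : (#|P| <= 3)%N by rewrite cardsE card_size.
    (* For [q >= 5], removing three elements leaves two. For [q = 4], the characteristic is 2, so
       [1] and [-1] coincide. *)
    case: (eqVneq q 4%N) => [eq4|ne4]; last by lia.
    have two0 : -1 = 1 :> F.
      apply/eqP; rewrite eq_sym -addr_eq0 -[_ == 0]orbb -mulf_eq0.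
      by rewrite -[X in _ == X]q0 eq4; apply/eqP; ring.
    suff : (#|P| <= 2)%N by lia.
    apply: leq_trans (card_size [:: 0; 1 : F]).
    by apply/subset_leq_card/subsetP => x; rewrite !inE two0 orbb.
  case/card_gt1P: Z2 => a [b [aZ bZ ab]].
  by exists a, b; split=> //; move: aZ bZ; rewrite !inE.
have [|D HD] := @magic_forms_proj_eval F t a b _ ab a3 b3; first by lia.
(* In characteristic 2, doubling is zero and a nonzero [c] leaves no fixed point; otherwise [c = 0]
   leaves only the fixed point 0. *)
have [c cfix] : exists c : 'rV[F]_t, forall x y : 'rV[F]_t,
    x + x = c -> y + y = c -> x = y.
  have dbl (x : 'rV[F]_t) : x + x = 2%:R *: x by rewrite scaler_nat.
  case: (eqVneq (2%:R : F) 0) => [two0|two0].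
    exists (const_mx 1) => x y; rewrite dbl two0 scale0r => /matrixP/(_ 0 (Ordinal t0)).
    by rewrite !mxE => /esym/eqP; rewrite oner_eq0.
  exists 0 => x y; rewrite !dbl => /eqP; rewrite scaler_eq0 (negbTE two0) => /eqP ->.
  by move/eqP; rewrite scaler_eq0 (negbTE two0) => /eqP ->.
move: a3; rewrite !inE !negb_or => /and3P[a0 a1 am].
have scale_inj (d : F) : d != 0 -> injective (fun x : 'rV[F]_t => d *: x).
  by move=> d0; apply: can_inj (scalerK _); rewrite ?unitfE.
apply: (@CMS_of_magic_forms F 'rV[F]_t q t D ( *:%R a) c) => //.
- by rewrite card_mx cardF mul1n.
- exact: scale_inj.
- apply: eq_inj (scale_inj (1 - a) _) _; first by rewrite subr_eq0 eq_sym.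
  by move=> x; rewrite scalerBl scale1r.
- apply: eq_inj (scale_inj (1 + a) _) _; first by rewrite addrC addr_eq0.
  by move=> x; rewrite scalerDl scale1r.
Qed.

(** * The case of order 9 *)

Definition quaternion_form (k : nat) (x y : 'rV['F_3]_2) : 'F_3 :=
  let x0 := x 0 0 in let x1 := x 0 1 in let y0 := y 0 0 in let y1 := y 0 1 in
  match k with
  | 0%N => x0 + y1
  | 1%N => x1 - y0
  | 2%N => x0 + x1 + y0 - y1
  | _ => x1 - x0 + y0 + y1
  end.

(* The remaining case is [q = 3], [t = 2], where no scalars other than [0], [1],
   [-1] are available. Viewed as 2x2 matrices, the four forms are the
   quaternions 1, i, j, k over the field with three elements. They are linearly
   independent, and the quotient of two of them squares to [-1], hence has no
   eigenvalue: this is what makes the forms magic. *)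
Lemma magic_forms_quaternion :
  magic_forms (fun k : 'I_(2 * 2) => quaternion_form k).
Proof.
have row0 (x : 'rV['F_3]_2) : x 0 0 = 0 -> x 0 1 = 0 -> x = 0.
  move=> x0 x1; apply/rowP => -[[|[|//]] lt_i]; rewrite mxE.
    by rewrite -x0; congr (x _ _); apply: val_inj.
  by rewrite -x1; congr (x _ _); apply: val_inj.
split.
- by move=> [[|[|[|[|//]]]] lt_k] x y x' y'; rewrite /quaternion_form [nat_of_ord _]/= !mxE; ring.
- move=> x y D0.
  have := D0 (inord 0); have := D0 (inord 1); have := D0 (inord 2).
  have := D0 (inord 3); rewrite /quaternion_form !inordK //.
  have : x 0 0 = 0 -> x 0 1 = 0 -> y 0 0 = 0 -> y 0 1 = 0 -> x = 0 /\ y = 0.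
    by move=> *; split; apply: row0.
  move: (x 0 0) (x 0 1) (y 0 0) (y 0 1).
  by do 4![case=> -[|[|[|//]]] ? //] => H *; apply: H; apply: val_inj.
move=> A /eqP /cards2P[k [l [kl ->]]] x y dir D0.
have := D0 _ (set21 k l); have := D0 _ (set22 k l) => {D0}.
wlog lt_kl : k l kl / (k < l)%N.
  move=> W; case: (ltngtP k l) => [lt|lt|/val_inj eq]; first exact: W.
    by move=> h1 h2; apply: (W l k); rewrite // eq_sym.
  by rewrite eq eqxx in kl.
case: k l lt_kl {kl} => [[|[|[|[|//]]]] lt_k] [[|[|[|[|//]]]] lt_l] // _.
all: rewrite /quaternion_form /=.
(* In each direction a single vector remains, and its nine values are checked for each of the six
   pairs of forms. *)
all: case: dir => ->; rewrite ?mxE => h1 h2;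
  [suff z0 : y = 0 by rewrite z0 | suff z0 : x = 0 by rewrite z0 ?oppr0 ..].
all: apply: row0; move: h1 h2;
  try (move: (x 0 0) (x 0 1); by case=> -[|[|[|//]]] ? [[|[|[|//]]] ?] // _ _; apply: val_inj).
all: move: (y 0 0) (y 0 1); by case=> -[|[|[|//]]] ? [[|[|[|//]]] ?] // _ _; apply: val_inj.
Qed.

(** The quarter turn [J] squares to [-1], a nonsquare modulo 3, so it has no eigenvalue: [J],
    [1 - J] and [1 + J] are injective. *)
Lemma CMS_exists_3_2 : exists B : 'I_(3 ^ 2) -> 'M[nat]_(3 ^ 2), CMS 2 B.
Proof.
pose J (x : 'rV['F_3]_2) : 'rV['F_3]_2 := \row_(i < 2) (if i == 0 then - x 0 1 else x 0 0).
have row_eq (x y : 'rV['F_3]_2) : x 0 0 = y 0 0 -> x 0 1 = y 0 1 -> x = y.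
  move=> x0 x1; apply/rowP => -[[|[|//]] lt_i].
    by move: x0; congr (x _ _ = y _ _); apply: val_inj.
  by move: x1; congr (x _ _ = y _ _); apply: val_inj.
apply: (CMS_of_magic_forms (J := J) (c := 0) _ _ magic_forms_quaternion).
- by rewrite card_Fp.
- by rewrite card_mx card_Fp.
all: move=> x y.
1-3: move=> /rowP e; have := e 0; have := e 1 => {e}; rewrite !mxE /=.
4: move=> + /esym xy; rewrite xy => /rowP e; have := e 0; have := e 1 => {e xy}; rewrite !mxE.
all: move=> h1 h2; apply: row_eq; move: h1 h2.
all: move: (x 0 0) (x 0 1) (y 0 0) (y 0 1).
all: by do 4![case=> -[|[|[|//]]] ?] => // *; apply: val_inj.
Qed.

Local Close Scope ring_scope.

Theorem theorem3p1 (t q : nat) :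
  2 <= t -> prime_power q -> 2 * t - 1 <= q ->
  exists B : 'I_(q ^ t) -> 'M[nat]_(q ^ t), CMS t B.
Proof.
move=> t2 [p [k [p_pr [k0 eq_q]]]] tq.
have [q4|q3] := leqP 4 q; last first.
  (* Indeed [3 <= 2 * t - 1 <= q < 4]. *)
  have -> : q = 3 by lia.
  have -> : t = 2 by lia.
  exact: CMS_exists_3_2.
have [F pF cardF] := pPrimePowerField p_pr k0.
apply: (@CMS_exists_large F) => //; [by rewrite cardF | | exact: ltnW].
by rewrite eq_q natrX (pcharf0 pF) expr0n; case: k k0 {eq_q cardF}.
Qed.
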